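(* Let $k=2$ and $n\ge1$. Let $T_1,T_2,T_3,T_4$ be subtrees of the binary cycle-joining trees $\mathcal{T}_1,\mathcal{T}_2,\mathcal{T}_3,\mathcal{T}_4$, respectively. For every $1\le c\le n$ and every $\ell\in\{\mathit{left},\mathit{right}\}$ and every $i\in\{1,2,3,4\}$, $U_i=\mathrm{RCL}(\mathrm{concat}(T_i,c,\ell))$ is a universal cycle for $\mathbf{S}_{T_i}$ with successor rule $\mathrm{PCR}_i$ (defined with respect to $T=T_i$).
   Context: Binary alphabet $\{0,1\}$; $\overline{\mathtt{a}}$ is the complement of bit $\mathtt{a}$. The aperiodic prefix $\mathrm{ap}(\alpha)$ of $\alpha$ is the shortest $\beta$ with $\alpha=\beta^q$; $|\beta|$ is the period; $\mathrm{ap}(\alpha_1,\dots,\alpha_t)=\mathrm{ap}(\alpha_1)\cdots\mathrm{ap}(\alpha_t)$. $[\alpha]$ is the set of rotations of $\alpha$; a necklace is the lexicographically least rotation. A universal cycle for $\mathbf{S}\subseteq\{0,1\}^n$ is a cyclic sequence of length $|\mathbf{S}|$ containing each string of $\mathbf{S}$ exactly once as a cyclic length-$n$ substring; a successor rule gives the symbol following each $\alpha\in\mathbf{S}$. Cycle-joining trees: nodes are the binary necklaces of length $n$ (standing for their classes). $\mathcal{T}_1$: root $1^n$, the parent of any other necklace is obtained by flipping its last 0. $\mathcal{T}_2$: root $0^n$, parent obtained by flipping the first 1. $\mathcal{T}_3$: root $0^n$, parent is the necklace of the string obtained by flipping the last 1. $\mathcal{T}_4$: root $1^n$, parent is the necklace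 of the string obtained by flipping the first 0. If the parent of the necklace $\alpha=\mathtt{a}_1\cdots\mathtt{a}_n$ is obtained by flipping position $i$, the edge is labeled by the conjugate pair $(\overline{\mathtt{a}}_i\mathtt{a}_{i+1}\cdots\mathtt{a}_n\mathtt{a}_1\cdots\mathtt{a}_{i-1},\ \mathtt{a}_i\mathtt{a}_{i+1}\cdots\mathtt{a}_n\mathtt{a}_1\cdots\mathtt{a}_{i-1})$ (parent-side string first). A subtree $T$ of $\mathcal{T}_i$ is a set of its nodes inducing a connected subgraph, with inherited edges and labels, rooted at its node closest to the root of $\mathcal{T}_i$; $\mathbf{S}_T$ is the union of the classes of its nodes. Concatenation tree $\mathrm{concat}(T,c,\ell)$: same nodes and parent relation; each node gets a label (string in its class) and a change index. The root has label its necklace and change index $c$. If a node has label $\alpha$ with change index $c'$ and period $p$, and $jp<c'\le jp+p$, its acceptable range is $\{jp+1,\dots,jp+p\}$. For a child joined by edge label $(\mathtt{x}\beta,\mathtt{y}\beta)$, write uniquely $\alpha=\beta_1\mathtt{x}\beta_2$ with $\beta_2\beta_1=\beta$ and $|\beta_1|+1$ in the acceptable range; the child gets label $\beta_1\mathtt{y}\beta_2$ and change index $|\beta_1|+1$. Children with change index $<c'$ are left-children, $>c'$ right-children, $=c'$ left-children if $\ell=\mathit{left}$ and right-children if $\ell=\mathit{right}$; each type ordered by increasing change index. An RCL traversal visits recursively the right-children subtrees first to last, then the node, then the left-children subtrees first to last; $\mathrm{RCL}(\cdot)=\mathrm{ap}(\alpha_1,\dots,\alpha_t)$ for the labels $\alpha_1,\dots,\alpha_t$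 in RCL order. Successor rules, for $\alpha=\mathtt{a}_1\cdots\mathtt{a}_n\in\mathbf{S}_T$; in each, $\mathrm{PCR}_i(\alpha)=\overline{\mathtt{a}}_1$ if $\gamma$ is a necklace and $\mathtt{a}_2\cdots\mathtt{a}_n\overline{\mathtt{a}}_1\in\mathbf{S}_T$, and $\mathrm{PCR}_i(\alpha)=\mathtt{a}_1$ otherwise, where $\gamma$ is: $\mathrm{PCR}_1$: $j$ is the smallest index $j>1$ with $\mathtt{a}_j=0$, or $j=n+1$ if none, and $\gamma=\mathtt{a}_j\mathtt{a}_{j+1}\cdots\mathtt{a}_n0\mathtt{a}_2\cdots\mathtt{a}_{j-1}$; $\mathrm{PCR}_2$: $j$ is the largest index with $\mathtt{a}_j=1$, or $j=0$ if none, and $\gamma=\mathtt{a}_{j+1}\cdots\mathtt{a}_n1\mathtt{a}_2\cdots\mathtt{a}_j$; $\mathrm{PCR}_3$: $\gamma=\mathtt{a}_2\mathtt{a}_3\cdots\mathtt{a}_n1$; $\mathrm{PCR}_4$: $\gamma=0\mathtt{a}_2\mathtt{a}_3\cdots\mathtt{a}_n$. *)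

(* Defs.v *)
(* Bits are booleans (0 = false, 1 = true).  Positions in a string and change
   indices are numbered from 1; list operations are 0-based, hence the .-1's. *)
From mathcomp Require Import all_boot all_order.

Set Implicit Arguments.
Unset Strict Implicit.
Unset Printing Implicit Defensive.

Section Strings.

Implicit Types s : seq bool.

(* The least p >= 1 with s = (prefix of length p)^q. *)
Definition period s : nat :=
  (find (fun p => s == flatten (nseq (size s %/ p.+1) (take p.+1 s)))
        (iota 0 (size s))).+1.

Definition ap s : seq bool := take (period s) s.

Definition aps (ss : seq (seq bool)) : seq bool := flatten (map ap ss).

(* seqlexi is the lexicographic order, with false < true on bool. *)
Definition necklace s : bool :=
  all (fun i => (s <= rot i s :> seqlexi bool)%O) (iota 0 (size s)).

(* Each of these is a position in 1..n if the bit b occurs in s (n = size s);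
   otherwise first_pos is n+1 and last_pos is 0. *)
Definition first_pos (b : bool) s : nat := (index b s).+1.
Definition last_pos (b : bool) s : nat := size s - index b (rev s).

End Strings.

Section CycleJoiningTrees.

Variable n : nat.
Implicit Types x y : n.-tuple bool.

Definition rotations x : {set n.-tuple bool} :=
  [set rot_tuple i x | i : 'I_n].

Definition necklace_of x : n.-tuple bool :=
  [arg min_(y < x in rotations x) (tval y : seqlexi bool)]%O.

Definition flip (m : nat) x : n.-tuple bool :=
  [tuple if j.+1 == m then ~~ tnth x j else tnth x j | j < n].

End CycleJoiningTrees.

(* The four trees T_1, T_2, T_3, T_4, named by the bit which is flipped to go
   from a necklace to its parent. *)
Inductive cjtree := Last0 | First1 | Last1 | First0.

Section Trees.

Variables (n : nat) (i : cjtree).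
Implicit Types x y : n.-tuple bool.
Implicit Types T : {set n.-tuple bool}.

Definition tree_root : n.-tuple bool :=
  match i with
  | Last0 | First0 => nseq_tuple n true
  | First1 | Last1 => nseq_tuple n false
  end.

Definition flip_pos x : nat :=
  match i with
  | Last0 => last_pos false x
  | First1 => first_pos true x
  | Last1 => last_pos true x
  | First0 => first_pos false x
  end.

(* Meaningful on necklaces.  At the root flip_pos is out of range, so that the
   root is its own parent. *)
Definition parent x : n.-tuple bool :=
  match i with
  | Last0 | First1 => flip (flip_pos x) x
  | Last1 | First0 => necklace_of (flip (flip_pos x) x)
  end.

Definition is_child_of y x : bool := (y != tree_root) && (parent y == x).

(* The conjugate pair on the edge between y and its parent, the parent-side
   string first. *)
Definition edge_label y : seq bool * seq bool :=
  (rot (flip_pos y).-1 (flip (flip_pos y) y), rot (flip_pos y).-1 y).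

(* The number of edges from x to the root. *)
Definition depth x : nat := findex parent x tree_root.

Definition induced_edge T x y : bool :=
  [&& x \in T, y \in T & is_child_of x y || is_child_of y x].

Definition is_subtree T : Prop :=
  [/\ T != set0,
      forall x, x \in T -> necklace x
    & forall x y, x \in T -> y \in T -> connect (induced_edge T) x y].

Definition subtree_root T : n.-tuple bool :=
  odflt tree_root
    [pick x in T | [forall y in T, depth x <= depth y]].

Definition strings_of T : {set n.-tuple bool} :=
  \bigcup_(x in T) rotations x.

End Trees.

(* Nodes carry a label and a change index, and have ordered lists of
   left-children and right-children. *)
Inductive concat_tree :=
  CNode of seq bool & nat & seq concat_tree & seq concat_tree.

Fixpoint rcl_labels (t : concat_tree) : seq (seq bool) :=
  let: CNode a _ ls rs := t in
  flatten (map rcl_labels rs) ++ a :: flatten (map rcl_labels ls).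

Definition RCL (t : concat_tree) : seq bool := aps (rcl_labels t).

Inductive side := Left | Right.

(* The acceptable range jp+1, ..., jp+p of a node with label a and change
   index c, where p is the period of a and jp < c <= jp+p. *)
Definition acceptable_range (a : seq bool) (c : nat) : seq nat :=
  iota (c.-1 %/ period a * period a).+1 (period a).

(* The position |b1|+1 of x in a = b1 x b2, where b2 b1 = b, for an edge label
   e = (x b, y b).  The default 0 is never reached in a concatenation tree. *)
Definition child_index (a : seq bool) (c : nat) (e : seq bool * seq bool)
    : nat :=
  head 0 [seq m <- acceptable_range a c
         | (nth false a m.-1 == head false e.1) &&
           (drop m a ++ take m.-1 a == behead e.1)].

(* The label b1 y b2, where m = |b1|+1. *)
Definition child_label (a : seq bool) (m : nat) (e : seq bool * seq bool)
    : seq bool :=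
  take m.-1 a ++ head false e.2 :: drop m a.

Section Concat.

Variables (n : nat) (i : cjtree) (T : {set n.-tuple bool}) (l : side).

Definition goes_left (c m : nat) : bool :=
  (m < c) || (m == c) && (if l is Left then true else false).

(* The part of the tree below the node x, with label a and change index c, down
   to [fuel] levels below x.  The first components of kids are the
   change indices of the children. *)
Fixpoint concat_below (fuel : nat) (x : n.-tuple bool) (a : seq bool) (c : nat)
    : concat_tree :=
  if fuel is fuel'.+1 then
    let kids := sort (fun k1 k2 => k1.1 <= k2.1)
      [seq (child_index a c (edge_label i y), y)
      | y <- enum T & is_child_of i y x] in
    let build := fun k : nat * n.-tuple bool =>
      concat_below fuel' k.2 (child_label a k.1 (edge_label i k.2)) k.1 in
    CNode a c [seq build k | k <- kids & goes_left c k.1]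
              [seq build k | k <- kids & ~~ goes_left c k.1]
  else CNode a c [::] [::].

End Concat.

(* The height of a tree with #|T| nodes is less than #|T|, so the fuel does not
   cut any branch. *)
Definition concat n (i : cjtree) (T : {set n.-tuple bool}) (c : nat) (l : side)
    : concat_tree :=
  concat_below i T l #|T| (subtree_root i T) (subtree_root i T) c.

Section UniversalCycles.

Variable n : nat.
Implicit Types (U : seq bool) (S : {set n.-tuple bool}) (a : n.-tuple bool).

(* U may be shorter than n, in which case a substring wraps around U several
   times. *)
Definition cyclic_substring U (p : nat) : seq bool :=
  mkseq (fun j => nth false U ((p + j) %% size U)) n.

Definition universal_cycle U S : Prop :=
  size U = #|S| /\
  forall a, a \in S ->
    exists! p : 'I_(size U), cyclic_substring U p = a.

Definition has_successor_rule U S (f : n.-tuple bool -> bool) : Prop :=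
  forall a (p : 'I_(size U)), a \in S ->
    cyclic_substring U p = a -> nth false U ((p + n) %% size U) = f a.

(* The string gamma, which has length n+1 in the case First1 if a = 0^n. *)
Definition pcr_test (i : cjtree) a : seq bool :=
  match i with
  | Last0 =>
      let j := (first_pos false (behead a)).+1 in
      drop j.-1 a ++ false :: behead (take j.-1 a)
  | First1 =>
      let j := last_pos true a in
      drop j a ++ true :: behead (take j a)
  | Last1 => rcons (behead a) true
  | First0 => false :: behead a
  end.

(* The string a_2 ... a_n (~~ a_1) is the rotation by 1 of (~~ a_1) a_2 ... a_n. *)
Definition PCR (i : cjtree) S a : bool :=
  let a1 := head false a in
  if necklace (pcr_test i a) && (rot_tuple 1 (flip 1 a) \in S)
  then ~~ a1 else a1.

End UniversalCycles.

(* Main.v *)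
(* Joining the rotation classes along the tree gives the rule succ_bit, which
   complements the first bit exactly at the two strings of each edge label; for
   the four trees each string lies on at most one edge, and the test of PCR_i
   recovers the child endpoint of that edge.  Following this rule around the
   tree is a closed walk: at the node with label a, the walk passes through the
   rotations of a in the order of the acceptable range, starting after the
   change index, and makes an excursion at the change index of every child.
   If E is the word emitted below a node with label a and change index c, and w
   is the RCL word of its subtree, then

     a_1 ... a_c E = w a_1 ... a_(c-1),

   by induction on the tree: an excursion to a child with change index m leaves
   the prefix a_1 ... a_(m-1) behind it, so that the prefixes telescope, and the
   wrap-around from the end of the acceptable range to its start emits ap(a).
   At the root this makes w conjugate to the word C of the closed walk.  The
   walk meets every string of S_T, and |w| = |S_T|, so that each string occurs
   once. *)

Require Import Defs.
From mathcomp Require Import all_boot all_order.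
From mathcomp Require Import zify.

Set Implicit Arguments.
Unset Strict Implicit.
Unset Printing Implicit Defensive.

Local Arguments period _ : simpl never.
Local Arguments acceptable_range _ _ : simpl never.

(** * Rotations and periods *)

Section Rotations.
Implicit Types s t u v : seq bool.

Definition conjugate s t := exists k, t = rot k s.

Lemma conjugate_refl s : conjugate s s.
Proof. by exists 0; rewrite rot0. Qed.

Lemma conjugateP s t :
  0 < size s -> conjugate s t -> exists2 k, k < size s & t = rot k s.
Proof.
move=> s0 [k ->]; case: (ltnP k (size s)) => hk; first by exists k.
by exists 0 => //; rewrite rot0 rot_oversize.
Qed.

Lemma conjugate_sym s t : conjugate s t -> conjugate t s.
Proof. by case=> k ->; exists (size (rot k s) - k); rewrite -/(rotr _ _) rotK. Qed.

Lemma conjugate_trans s t u : conjugate s t -> conjugate t u -> conjugate s u.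
Proof.
case=> k -> [m ->]; case: (leqP (size s) k) => hk.
  by rewrite (rot_oversize hk); exists m.
case: (leqP (size s) m) => hm.
  by rewrite [rot m _]rot_oversize ?size_rot //; exists k.
by eexists; apply: rot_add_mod; apply: ltnW.
Qed.

Lemma conjugate_size s t : conjugate s t -> size t = size s.
Proof. by case=> k ->; rewrite size_rot. Qed.

Lemma nth_rot s k j : k <= size s -> j < size s ->
  nth false (rot k s) j = nth false s ((k + j) %% size s).
Proof.
move=> hk hj; rewrite /rot nth_cat size_drop nth_drop.
case: (ltnP j (size s - k)) => h; first by rewrite modn_small //; lia.
rewrite nth_take; last by lia.
have -> : k + j = j - (size s - k) + size s by lia.
by rewrite modnDr modn_small //; lia.
Qed.

Lemma rot_mul s d k : rot d s = s -> d <= size s ->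
  rot ((k * d) %% size s) s = s.
Proof.
case: (posnP (size s)) => [s0|s0] hd hle.
  by rewrite rot_oversize // s0.
elim: k => [|k IH]; first by rewrite mul0n mod0n rot0.
set m := (k * d) %% size s in IH *.
have hm : m < size s by rewrite ltn_mod.
have := rot_add_mod (ltnW hm) hle; rewrite IH hd.
rewrite mulSn -modnDmr -/m => E; case: ifP E => h E.
  case: (ltngtP (d + m) (size s)) => h'; [|lia|].
    by rewrite modn_small.
  by rewrite h' modnn rot0.
have -> : d + m = d + m - size s + size s by lia.
by rewrite modnDr modn_small //; lia.
Qed.

Lemma nth_flatten_nseq q t i : i < q * size t ->
  nth false (flatten (nseq q t)) i = nth false t (i %% size t).
Proof.
elim: q i => [|q IH] i //=; rewrite mulSn nth_cat => hi.
case: ltnP => h; first by rewrite modn_small.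
by rewrite IH; [rewrite -{2}(subnK h) modnDr | lia].
Qed.

Lemma size_flatten_nseq q t : size (flatten (nseq q t)) = q * size t.
Proof. by elim: q => //= q IH; rewrite size_cat IH mulSn. Qed.

Lemma rot_dvd_power s g : 0 < g -> g <= size s -> g %| size s -> rot g s = s ->
  s = flatten (nseq (size s %/ g) (take g s)).
Proof.
move=> g0 hg gd hr; apply: (@eq_from_nth _ false).
  by rewrite size_flatten_nseq size_takel // divnK.
move=> i hi; rewrite nth_flatten_nseq size_takel ?divnK //.
rewrite nth_take ?ltn_mod //.
have step k r : k * g + r < size s -> nth false s (k * g + r) = nth false s r.
  elim: k => [|k IH]; rewrite ?mul0n // mulSn -addnA => hk.
  rewrite -IH ?(leq_ltn_trans (leq_addl g _) hk) //.
  by rewrite -[in RHS]hr nth_rot ?modn_small // (leq_ltn_trans (leq_addl g _) hk).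
by rewrite [in LHS](divn_eq i g) step -?divn_eq.
Qed.

Lemma is_period_power s p : p.+1 <= size s ->
  s == flatten (nseq (size s %/ p.+1) (take p.+1 s)) ->
  (p.+1 %| size s) /\ rot p.+1 s = s.
Proof.
move=> hp /eqP E.
have D : size s %/ p.+1 * p.+1 = size s.
  by rewrite [in RHS]E size_flatten_nseq size_takel.
split; first by rewrite -D dvdn_mull.
apply: (@eq_from_nth _ false); rewrite size_rot // => i hi.
rewrite nth_rot // [X in nth _ X _ = _]E [X in _ = nth _ X _]E.
have hm : (p.+1 + i) %% size s < size s by rewrite ltn_mod; lia.
rewrite !nth_flatten_nseq ?size_takel ?D //.
by rewrite modn_dvdm ?modnDl // -D dvdn_mull.
Qed.

Lemma period_bounds s : 0 < size s -> 0 < period s <= size s.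
Proof.
move=> s0; rewrite /period /=.
set P := fun p => _; set r := iota _ _.
suff : has P r by rewrite has_find size_iota.
apply/hasP; exists (size s).-1; first by rewrite mem_iota; lia.
by rewrite /P prednK // divnn s0 take_size /= cats0.
Qed.

Lemma period_power s : 0 < size s ->
  (period s %| size s) /\ rot (period s) s = s.
Proof.
move=> s0; have := period_bounds s0; rewrite /period.
set P := fun p => _; set r := iota _ _ => /andP[_ h].
have hP : has P r by rewrite has_find size_iota.
apply: is_period_power => //.
by have := nth_find 0 hP; rewrite nth_iota // add0n.
Qed.

Lemma period_min s d : 0 < d < period s -> rot d s != s.
Proof.
move=> /andP[d0 dp]; apply/eqP => E.
have s0 : 0 < size s.
  by case: s dp {E} => // dp; move: dp d0; rewrite /period /=; case: d.
have /andP[_ ps] := period_bounds s0.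
have ds : d <= size s by lia.
have [k _ hk] := Bezoutl (size s) d0.
set g := gcdn d (size s) in hk.
have g0 : 0 < g by rewrite gcdn_gt0 d0.
have gd : g <= d by apply: dvdn_leq => //; apply: dvdn_gcdl.
have gs : g %| size s by apply: dvdn_gcdr.
have Eg : rot g s = s.
  case/dvdnP: hk => q hq; have := rot_mul q E ds.
  rewrite -hq addnC modnMDl modn_small //.
  by have /andP[_ h] := period_bounds s0; lia.
have gl : g <= size s by lia.
have := rot_dvd_power g0 gl gs Eg => /eqP H.
have : find (fun p => s == flatten (nseq (size s %/ p.+1) (take p.+1 s)))
        (iota 0 (size s)) > g.-1 by move: dp; rewrite /period; lia.
move/(before_find 0); rewrite nth_iota; last by lia.
by rewrite add0n prednK // H.
Qed.

Lemma size_ap s : 0 < size s -> size (ap s) = period s.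
Proof. by move=> s0; rewrite size_takel //; case/andP: (period_bounds s0). Qed.

(* The acceptable range for the change index c is
   block s c + 1, ..., block s c + period s. *)
Definition block s c := c.-1 %/ period s * period s.

Lemma block_bounds s c : 0 < c <= size s ->
  block s c < c <= block s c + period s /\ block s c + period s <= size s.
Proof.
move=> hc; have s0 : 0 < size s by lia.
have /andP[p0 ps] := period_bounds s0.
have [pd _] := period_power s0; rewrite /block.
have := divn_eq c.-1 (period s); have := ltn_pmod c.-1 p0.
set q := _ %/ _ => h1 h2; split; first by lia.
rewrite addnC -mulSn -(divnK pd) leq_mul2r; apply/orP; right.
rewrite ltn_divRL //; apply: leq_ltn_trans (_ : c.-1 < _); last by lia.
by apply: leq_trunc_div.
Qed.

Lemma rot_block_inj s c i j : 0 < c <= size s ->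
  block s c <= i < block s c + period s -> block s c <= j < block s c + period s ->
  rot i s = rot j s -> i = j.
Proof.
move=> hc; have [_ hb] := block_bounds hc.
wlog ij : i j / i <= j.
  move=> H hi hj E; case: (leqP i j) => h; first exact: (H i j).
  by symmetry; apply: (H j i) => //; apply: ltnW.
move=> hi hj E; case: (posnP (j - i)) => h; first by lia.
have hd : 0 < j - i < period s.
  by lia.
have /negP[] := period_min hd.
have hjs : j <= size s by lia.
by apply/eqP/(@rot_inj i); rewrite -rotD ?subnKC.
Qed.

Lemma rot_mul_period s k : 0 < size s -> k * period s <= size s ->
  rot (k * period s) s = s.
Proof.
move=> s0; have [pd E] := period_power s0; elim: k => [|k IH]; first by rewrite rot0.
by move=> h; rewrite mulSn rotD; [rewrite IH // | rewrite -mulSn]; lia.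
Qed.

Lemma rot_block s c : 0 < c <= size s -> rot (block s c) s = s.
Proof.
move=> hc; apply: rot_mul_period; first by lia.
by case: (block_bounds hc); rewrite /block; lia.
Qed.

Lemma rot_block_end s c : 0 < c <= size s -> rot (block s c + period s) s = s.
Proof.
move=> hc; rewrite /block addnC -mulSn; apply: rot_mul_period; first by lia.
by case: (block_bounds hc); rewrite /block mulSn; lia.
Qed.

Lemma take_block_end s c : 0 < c <= size s ->
  take (block s c + period s) s = ap s ++ take (block s c) s.
Proof.
move=> hc; have [_ hb] := block_bounds hc.
have s0 : 0 < size s by lia.
have [_ E] := period_power s0.
rewrite addnC takeD; congr (_ ++ _).
have : take (block s c) (rot (period s) s) = take (block s c) s by rewrite E.
by rewrite {1}/rot takel_cat // size_drop; lia.
Qed.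

Lemma conjugate_block s t c : 0 < c <= size s -> conjugate s t ->
  exists2 k, block s c <= k < block s c + period s & t = rot k s.
Proof.
move=> hc /conjugateP [|k hk ->]; first by lia.
have s0 : 0 < size s by lia.
have [hb1 hb2] := block_bounds hc.
have /andP[p0 ps] := period_bounds s0.
have R : rot k s = rot (k %% period s) s.
  rewrite {1}(divn_eq k (period s)) addnC rotD ?rot_mul_period //; last first.
    by rewrite addnC -divn_eq ltnW.
  by apply: leq_trans (leq_trunc_div _ _) (ltnW hk).
have hm := ltn_pmod k p0.
exists (block s c + k %% period s); first by lia.
by rewrite R addnC rotD ?rot_block //; lia.
Qed.

End Rotations.

(** * Necklaces *)

Section Lexicographic.
Implicit Types s t u v w z p q : seq bool.

Definition lexle s t : bool := (s <= t :> seqlexi bool)%O.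

Lemma lexle_cons a s b t :
  lexle (a :: s) (b :: t) = if a == b then lexle s t else b.
Proof. by rewrite /lexle lexi_cons; case: a; case: b. Qed.

Lemma lexle_refl s : lexle s s.
Proof. exact: Order.POrderTheory.lexx. Qed.

Lemma lexle_anti s t : lexle s t -> lexle t s -> s = t.
Proof. by move=> h1 h2; apply: (@Order.POrderTheory.le_anti _ (seqlexi bool)); apply/andP. Qed.

Lemma lexle_cat p q s t : size p = size q ->
  lexle (p ++ s) (q ++ t) = if p == q then lexle s t else lexle p q.
Proof.
elim: p q => [|a p IH] [|b q] //= [E].
by rewrite !lexle_cons IH // eqseq_cons; case: eqP => //= _; case: eqP.
Qed.

Lemma lexle_prefix p s t : lexle (p ++ s) (p ++ t) = lexle s t.
Proof. by rewrite lexle_cat // eqxx. Qed.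

Lemma conjugate_cat s t :
  conjugate s t -> exists a b, s = a ++ b /\ t = b ++ a.
Proof. by case=> k ->; exists (take k s), (drop k s); rewrite cat_take_drop. Qed.

Lemma cat_conjugate s t : conjugate (s ++ t) (t ++ s).
Proof. by exists (size s); rewrite rot_size_cat. Qed.

Lemma necklaceP s :
  reflect (forall t, conjugate s t -> lexle s t) (necklace s).
Proof.
apply: (iffP allP) => H.
  case: (posnP (size s)) => [/size0nil -> t [k ->]|s0 t].
    by rewrite rot_oversize.
  by case/(conjugateP s0) => k hk ->; apply: H; rewrite mem_iota.
by move=> k _; apply: H; exists k.
Qed.

Lemma necklace_conjugate_eq s t :
  necklace s -> necklace t -> conjugate s t -> s = t.
Proof.
move=> /necklaceP hs /necklaceP ht h; apply: lexle_anti; first exact: hs.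
by apply: ht; apply: conjugate_sym.
Qed.

Lemma necklace_nseq k b : necklace (nseq k b).
Proof.
apply/necklaceP => t /conjugate_cat [u [v [E ->]]].
suff -> : v ++ u = nseq k b by apply: lexle_refl.
have /all_pred1P : all (pred1 b) (v ++ u).
  by rewrite all_cat andbC -all_cat -E all_nseq /= eqxx orbT.
by rewrite size_cat addnC -size_cat -E size_nseq.
Qed.

Lemma cat_index b s : b \in s -> exists v, s = nseq (index b s) (~~ b) ++ b :: v.
Proof.
elim: s => //= a s IH; rewrite inE; case: eqP => [<- _|/eqP h /=].
  by rewrite eqxx; exists s.
move/IH => [v E]; exists v.
have -> : (a == b) = false by rewrite eq_sym; apply/negbTE.
by rewrite /= -E; congr (_ :: _); move: h; case: (a); case: (b).
Qed.

Lemma cat_last_index b s : b \in s ->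
  exists v, s = v ++ b :: nseq (index b (rev s)) (~~ b).
Proof.
rewrite -mem_rev => /cat_index [v E]; exists (rev v).
rewrite -[LHS]revK [in LHS]E rev_cat rev_cons cat_rcons.
by congr (_ ++ _ :: _); rewrite rev_nseq.
Qed.

Lemma necklace_false s : necklace s -> false \in s -> exists u, s = false :: u.
Proof.
move=> /necklaceP hs /cat_index [v E].
move: (hs (false :: v ++ nseq (index false s) true)).
case: s E {hs} => [|[] u] E.
- by case: index E.
- rewrite [X in conjugate X _]E => /(_ (cat_conjugate _ _)).
  by rewrite lexle_cons.
- by exists u.
Qed.

Lemma necklace_true s : necklace s -> true \in s -> exists u, s = rcons u true.
Proof.
move=> /necklaceP; case/lastP: s => // s [] hs ht; first by exists s.
have {}ht : true \in s by move: ht; rewrite mem_rcons inE.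
have := hs (false :: s); rewrite -cats1 => /(_ (cat_conjugate _ _)).
have [v ->] := cat_index ht; set k := index _ _.
have -> : false :: nseq k false ++ true :: v = nseq k false ++ false :: true :: v.
  by elim: k => //= k ->.
by rewrite -catA lexle_prefix lexle_cons.
Qed.

Lemma cat_cat_split u v a b : a ++ b = u ++ v ->
  (exists w, u = a ++ w /\ b = w ++ v) \/ (exists w, a = u ++ w /\ v = w ++ b).
Proof.
elim: u a => [|x u IH] [|y a] /=; first by move=> ->; left; exists [::].
- by move=> <-; right; exists (y :: a).
- by move=> ->; left; exists (x :: u).
- by case=> -> /IH [[w [-> ->]]|[w [-> ->]]]; [left|right]; exists w.
Qed.

Lemma nseq_cat_inv k (b : bool) w z : nseq k b = w ++ z ->
  w = nseq (size w) b /\ z = nseq (size z) b.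
Proof.
move=> E; have : all (pred1 b) (w ++ z) by rewrite -E all_nseq /= eqxx orbT.
by rewrite all_cat => /andP[/all_pred1P <- /all_pred1P <-].
Qed.

Lemma necklace_raise_last u k :
  necklace (u ++ false :: nseq k true) -> necklace (u ++ nseq k.+1 true).
Proof.
case: u => [|x u] hs; first exact: necklace_nseq.
have [u' hu] : exists u', x :: u = false :: u'.
  have [] := necklace_false hs; first by rewrite mem_cat mem_head orbT.
  by move=> w /= [-> _]; exists u.
move: hs; rewrite {}hu => /necklaceP hs; set u2 := false :: u' in hs *.
apply/necklaceP => t /conjugate_cat [a [b [/esym E ->]]].
case: (cat_cat_split E) => [[w [Eu ->]]|[w [Ea Ev]]]; last first.
  case: b E Ev => [|y b] E Ev; first by rewrite -E cats0 lexle_refl.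
  have [_] := nseq_cat_inv Ev; case=> -> _.
  by rewrite /u2 lexle_cons.
case: a E Eu => [|y a] E Eu; first by rewrite cats0 Eu lexle_refl.
have : conjugate (u2 ++ false :: nseq k true)
    ((w ++ false :: nseq k true) ++ y :: a).
  by have := cat_conjugate (y :: a) (w ++ false :: nseq k true); rewrite Eu catA.
move/hs; rewrite Eu.
have [p [c [z [-> Ep]]]] : exists p c z,
    (y :: a) ++ w = p ++ c :: z /\ size p = size w.
  have h : size w < size ((y :: a) ++ w) by rewrite size_cat /=; lia.
  exists (take (size w) ((y :: a) ++ w)), (nth false ((y :: a) ++ w) (size w)),
    (drop (size w).+1 ((y :: a) ++ w)).
  by rewrite -drop_nth // cat_take_drop size_takel // ltnW.
rewrite -!catA !(lexle_cat _ _ Ep); case: ifP => // _.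
by rewrite !lexle_cons; case: (c).
Qed.

Lemma necklace_lower_first k v :
  necklace (nseq k false ++ true :: v) -> necklace (nseq k.+1 false ++ v).
Proof.
case: (lastP v) => [|v' x] hs; first by rewrite cats0; apply: necklace_nseq.
have {hs} [hs hx] : necklace (nseq k false ++ true :: rcons v' x) /\ x = true.
  split => //; have [] := necklace_true hs; first by rewrite mem_cat mem_head orbT.
  by move=> u; rewrite -rcons_cons -rcons_cat => /rcons_inj [].
move: hs hx; set s := rcons v' x => /necklaceP hs hx.
apply/necklaceP => t /conjugate_cat [a [b [/esym E ->]]].
have zeros j e z1 z2 : lexle (nseq j.+1 false ++ nseq e false ++ z1)
    (nseq e false ++ true :: z2).
  by rewrite catA -nseqD addnC nseqD -catA lexle_prefix lexle_cons.
case: (cat_cat_split E) => [[w [Eu ->]]|[w [Ea Ev]]].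
  have [Ha Hw] := nseq_cat_inv Eu.
  case: a E Eu Ha => [|a0 a] E Eu Ha; first by rewrite cats0 Eu lexle_refl.
  have Hsz : k.+1 = size w + (size a).+1.
    by rewrite addnC -/(size (a0 :: a)) -size_cat -Eu size_nseq.
  rewrite Hsz nseqD -Hw -!catA lexle_prefix.
  have [v1 ->] : exists v, s = nseq (index true s) false ++ true :: v.
    by apply: cat_index; rewrite /s hx mem_rcons inE eqxx.
  by rewrite Ha -catA; apply: zeros.
case: (lastP b) Ev E => [|b' y] Ev E; first by rewrite -E cats0 lexle_refl.
have hy : y = true by move: Ev; rewrite /s -rcons_cat => /rcons_inj [_ <-].
have [z Ez] : exists v, rcons b' y = nseq (index true (rcons b' y)) false ++ true :: v.
  by apply: cat_index; rewrite hy mem_rcons inE eqxx.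
set e := index _ _ in Ez.
case: (leqP e k) => he.
  rewrite Ez -(subnKC he) -addnS nseqD -!catA lexle_prefix /=.
  by rewrite lexle_cons.
have := hs (rcons b' y ++ nseq k false ++ true :: w).
rewrite Ev -cat_cons catA => /(_ (cat_conjugate _ _)).
rewrite -catA Ez -(subnKC he) addSnnS nseqD -!catA lexle_prefix /=.
by rewrite lexle_cons.
Qed.

End Lexicographic.

(** * The four trees *)

Section NecklaceOf.
Variable n : nat.
Hypothesis n_gt0 : 0 < n.
Implicit Types x y : n.-tuple bool.

Lemma rotationsP x y : reflect (conjugate x y) (y \in rotations x).
Proof.
apply: (iffP imsetP) => [[k _ ->]|]; first by exists k.
case/conjugateP; first by rewrite size_tuple.
move=> k hk E; rewrite size_tuple in hk.
by exists (Ordinal hk) => //; apply: val_inj.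
Qed.

Lemma necklace_ofP x :
  conjugate x (necklace_of x) /\ necklace (necklace_of x).
Proof.
rewrite /necklace_of.
case: (@Order.TotalTheory.arg_minP _ _ _ x (mem (rotations x))
  (fun y => tval y : seqlexi bool)).
  by apply/rotationsP/conjugate_refl.
move=> y /rotationsP hy hmin; split => //; apply/necklaceP => t ht.
have hs : size t == n by rewrite (conjugate_size ht) size_tuple.
apply: (hmin (Tuple hs)); apply/rotationsP.
exact: conjugate_trans ht.
Qed.

Lemma val_flip (m : nat) x : 0 < m <= n ->
  flip m x = take m.-1 x ++ ~~ nth false x m.-1 :: drop m x :> seq bool.
Proof.
case: m => // m /= hm.
have hx : size x = n by rewrite size_tuple.
have hf : size (flip m.+1 x) = n by rewrite size_tuple.
apply: (@eq_from_nth _ false); rewrite -/(tval (flip m.+1 x)).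
  by rewrite hf size_cat /= size_takel ?size_drop hx; lia.
move=> j; rewrite hf => hj.
have -> : nth false (flip m.+1 x) j = tnth (flip m.+1 x) (Ordinal hj).
  by rewrite (tnth_nth false).
rewrite tnth_mktuple (tnth_nth false) /=.
rewrite nth_cat size_takel; last by rewrite hx ltnW.
rewrite eqSS; case: (ltngtP j m) => h.
- by rewrite nth_take.
- have [d ->] : exists d, j = m + d.+1 by exists (j - m.+1); lia.
  by rewrite addKn /= nth_drop addSnnS.
- by rewrite h subnn.
Qed.

End NecklaceOf.

Lemma index_traject (T : eqType) (f : T -> T) x y m1 m2 :
  y \in traject f x m1 -> m1 <= m2 ->
  index y (traject f x m1) = index y (traject f x m2).
Proof. by move=> h hm; rewrite -(subnKC hm) trajectD index_cat h. Qed.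

Lemma findex_step (T : finType) (f : T -> T) x y : fconnect f x y -> x != y ->
  findex f x y = (findex f (f x) y).+1.
Proof.
move=> hc hxy; have hy : y \in traject f x (order f x) by rewrite -/(orbit f x) -fconnect_orbit.
have hfy : fconnect f (f x) y.
  have := iter_findex hc; case: (findex f x y) => [/= E|k]; first by rewrite E eqxx in hxy.
  by rewrite iterSr => <-; apply: fconnect_iter.
rewrite /findex /orbit in hy *; rewrite -orderSpred in hy *.
rewrite /= in hy *; rewrite inE eq_sym (negbTE hxy) /= in hy *; congr _.+1.
have hf' : y \in traject f (f x) (order f (f x)) by rewrite -/(orbit f (f x)) -fconnect_orbit.
case/orP: (leq_total (order f x).-1 (order f (f x))) => h; first exact: index_traject.
by symmetry; apply: index_traject.
Qed.

Definition flip_bit (i : cjtree) : bool :=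
  match i with Last0 | First0 => false | First1 | Last1 => true end.

Section TreeStructure.
Variables (n : nat) (i : cjtree).
Hypothesis n_gt0 : 0 < n.
Implicit Types x y : n.-tuple bool.
Let b := flip_bit i.

(* The conjugate pair of the edge from y to its parent is
   (~~ b :: edge_core y, b :: edge_core y). *)
Definition edge_core y : seq bool :=
  drop (flip_pos i y) y ++ take (flip_pos i y).-1 y.

Lemma tree_rootE : tree_root n i = nseq n (~~ b) :> seq bool.
Proof. by rewrite /b; case: (i). Qed.

Lemma flip_bit_mem y : y != tree_root n i -> b \in y.
Proof.
apply: contraNT => hb; apply/eqP/val_inj; rewrite /= tree_rootE.
rewrite -{2}(size_tuple y); apply/all_pred1P/allP => c hc /=.
by move: hb hc; case: (b); case: c => //= /negP H /H.
Qed.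

Lemma flip_pos_cat y u v : y = u ++ b :: v :> seq bool ->
  match i with Last0 | Last1 => b \notin v | _ => b \notin u end ->
  flip_pos i y = (size u).+1.
Proof.
have first : y = u ++ b :: v :> seq bool -> b \notin u ->
    first_pos b y = (size u).+1.
  by move=> E hu; rewrite /first_pos E index_cat (negbTE hu) /= eqxx addn0.
have last : y = u ++ b :: v :> seq bool -> b \notin v ->
    last_pos b y = (size u).+1.
  move=> E hv; rewrite /last_pos E rev_cat rev_cons cat_rcons index_cat mem_rev.
  by rewrite (negbTE hv) /= eqxx addn0 size_rev size_cat /=; lia.
move: first last; rewrite /flip_pos /b.
by case: (i) => /= H1 H2; [apply: H2 | apply: H1 | apply: H2 | apply: H1].
Qed.

Lemma notin_nseq k (c : bool) : c \notin nseq k (~~ c).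
Proof. by rewrite mem_nseq; case: c; rewrite andbF. Qed.

Lemma flip_decomposition y : necklace y -> y != tree_root n i ->
  exists u v, [/\ y = u ++ b :: v :> seq bool, flip_pos i y = (size u).+1 &
    match i with
    | Last0 => v = nseq (size v) true
    | First1 => u = nseq (size u) false
    | Last1 => v = [::]
    | First0 => u = [::]
    end].
Proof.
move=> hy /flip_bit_mem hb; have := flip_pos_cat; move: (@flip_pos_cat y).
have [v1 E1] := cat_index hb; have [v2 E2] := cat_last_index hb.
rewrite /b in hb E1 E2 *; case: (i) hb E1 E2 => /= hb E1 E2 H _.
- exists v2, (nseq (index false (rev y)) true); rewrite (H _ _ E2) ?size_nseq //.
  exact: (notin_nseq _ false).
- exists (nseq (index true y) false), v1; rewrite (H _ _ E1) ?size_nseq //.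
  exact: (notin_nseq _ true).
- have [u E] := necklace_true hy hb; exists u, [::].
  by rewrite cats1 (H u [::]) // cats1.
- have [u E] := necklace_false hy hb; exists [::], u.
  by rewrite (H [::] u).
Qed.

Lemma edge_core_cat y u v : y = u ++ b :: v :> seq bool ->
  flip_pos i y = (size u).+1 -> edge_core y = v ++ u.
Proof.
by rewrite /edge_core => -> -> /=; rewrite take_size_cat // -cat_rcons drop_size_cat ?size_rcons.
Qed.

Lemma val_flip_pos y u v : y = u ++ b :: v :> seq bool ->
  flip_pos i y = (size u).+1 ->
  flip (flip_pos i y) y = u ++ ~~ b :: v :> seq bool.
Proof.
move=> E hf; have hs := size_tuple y; rewrite E size_cat /= in hs.
have hm : 0 < flip_pos i y <= n by rewrite hf; lia.
rewrite (@val_flip _ n_gt0 _ _ hm) hf E /= take_size_cat // nth_cat ltnn subnn /=.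
by rewrite -[in drop _ _]cat_rcons drop_size_cat ?size_rcons.
Qed.

Lemma edge_labelE y : necklace y -> y != tree_root n i ->
  edge_label i y = (~~ b :: edge_core y, b :: edge_core y).
Proof.
move=> hy /(flip_decomposition hy) [u [v [E hf _]]].
rewrite /edge_label (edge_core_cat E hf) (val_flip_pos E hf) hf E /=.
by rewrite !rot_size_cat.
Qed.

Lemma conjugate_child y : necklace y -> y != tree_root n i ->
  conjugate y (b :: edge_core y).
Proof.
move=> hy /(flip_decomposition hy) [u [v [E hf _]]].
by rewrite (edge_core_cat E hf) E; apply: (cat_conjugate u (b :: v)).
Qed.

Lemma conjugate_parent y : necklace y -> y != tree_root n i ->
  conjugate (parent i y) (~~ b :: edge_core y).
Proof.
move=> hy /(flip_decomposition hy) [u [v [E hf _]]].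
have h : conjugate (flip (flip_pos i y) y) (~~ b :: edge_core y).
  rewrite (val_flip_pos E hf) (edge_core_cat E hf).
  exact: (cat_conjugate u (~~ b :: v)).
have h' := conjugate_trans (conjugate_sym (necklace_ofP n_gt0 (flip (flip_pos i y) y)).1) h.
by rewrite /parent; move: h h'; case: (i).
Qed.

Lemma necklace_parent y : necklace y -> y != tree_root n i ->
  necklace (parent i y).
Proof.
move=> hy /(flip_decomposition hy) [u [v [E hf]]].
have := val_flip_pos E hf; rewrite E in hy.
have [_] := necklace_ofP n_gt0 (flip (flip_pos i y) y).
rewrite /parent /b in hy *; case: (i) hy => //= hy _ -> H.
  by rewrite H; apply: (@necklace_raise_last u); rewrite -H.
have -> : u ++ false :: v = nseq (size u).+1 false ++ v.
  by rewrite -cat_rcons -addn1 nseqD -H cats1.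
by apply: necklace_lower_first; rewrite -H.
Qed.

Lemma count_parent y : necklace y -> y != tree_root n i ->
  count_mem b (parent i y) < count_mem b y.
Proof.
move=> hy hr.
have cc s t : conjugate s t -> count_mem b s = count_mem b t.
  by case=> k ->; apply/permP; rewrite perm_sym perm_rot.
rewrite (cc _ _ (conjugate_child hy hr)) (cc _ _ (conjugate_parent hy hr)).
by rewrite /= eqxx; case: (b).
Qed.

Lemma fconnect_tree_root y : necklace y -> fconnect (parent i) y (tree_root n i).
Proof.
have [m] := ubnP (count_mem b y); elim: m y => // m IH y hm hy.
case: (eqVneq y (tree_root n i)) => [-> //|hr].
apply: connect_trans (fconnect1 _ _) (IH _ _ (necklace_parent hy hr)).
by apply: leq_trans (count_parent hy hr) _.
Qed.

Lemma depth_parent y : necklace y -> y != tree_root n i ->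
  depth i y = (depth i (parent i y)).+1.
Proof. by move=> hy hr; apply: findex_step => //; apply: fconnect_tree_root. Qed.

Lemma pcr_testP (s : n.-tuple bool) :
  necklace (pcr_test i s) <->
  exists y : n.-tuple bool,
    [/\ necklace y, y != tree_root n i & behead s = edge_core y].
Proof.
have hsz := size_tuple s; case: s hsz => -[|x s] /= hs0 hs; first by lia.
have build u v : size (u ++ b :: v) = n -> necklace (u ++ b :: v) -> s = v ++ u ->
    match i with Last0 | Last1 => b \notin v | _ => b \notin u end ->
    exists y : n.-tuple bool,
    [/\ necklace y, y != tree_root n i & s = edge_core y].
  move=> /eqP hz hnk E hm; exists (Tuple hz); split => //.
    apply/negP => /eqP /(congr1 val) /=; rewrite tree_rootE => E'.
    have := notin_nseq n b; rewrite -E' mem_cat mem_head orbT //.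
  by rewrite (@edge_core_cat _ u v) //; apply: flip_pos_cat.
have b1 m : necklace (nseq m false ++ [:: true]).
  by apply: (@necklace_raise_last (nseq m false) 0); rewrite -(nseqD m 1); apply: necklace_nseq.
split.
  rewrite /b in build *; case: (i) build => /= build.
  - set k := index false s; rewrite /first_pos -/k => hnk.
    have hk : take k s = nseq (size (take k s)) true.
      apply/all_pred1P; rewrite /k; elim: (s) => //= -[] //= l IH.
    apply: (build _ _ _ hnk).
    + by rewrite size_cat /= addnS -size_cat -[RHS]hs /= !size_cat addnC -size_cat cat_take_drop.
    + by rewrite cat_take_drop.
    + by rewrite hk; apply: (notin_nseq _ false).
  - case: (boolP (true \in s)) => ht.
      have [w E] := cat_last_index ht; set k := index _ _ in E.
      have -> : last_pos true (x :: s) = (size w).+2.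
        rewrite /last_pos E rev_cons rev_cat rev_cons -cats1 -cats1 -!catA index_cat.
        rewrite mem_rev mem_nseq andbF /= size_rev size_nseq size_cat /= size_nseq; lia.
      rewrite -cat_rcons in E; rewrite E /= => hnk.
      rewrite drop_size_cat ?size_rcons // take_size_cat ?size_rcons // in hnk.
      rewrite -E; apply: (build _ _ _ hnk) => //; last exact: (notin_nseq _ true).
      by rewrite -hs /= E !size_cat /= size_rcons; lia.
    have E : s = nseq (size s) false.
      by apply/all_pred1P/allP => -[] // h; rewrite h in ht.
    move=> _; apply: (build (nseq (size s) false) [::]) => //.
      by rewrite size_cat size_nseq /= addn1.
    exact: (notin_nseq _ true).
  - by move=> hnk; apply: (build s [::]); rewrite ?cats1 ?size_rcons.
  - by move=> hnk; apply: (build [::] s); rewrite ?cats0.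
case=> y [hy hr]; have [u [v [E hf]]] := flip_decomposition hy hr.
rewrite (edge_core_cat E hf) => hv Es; move: hy hv; rewrite E.
rewrite /= in Es; rewrite /b in build *.
case: (i) build => /= build; rewrite Es => hy hv.
- rewrite /first_pos; suff -> : index false (v ++ u) = size v.
    by rewrite take_size_cat // drop_size_cat.
  rewrite index_cat hv (negbTE (notin_nseq _ false)) size_nseq.
  suff -> : index false u = 0 by rewrite addn0.
  case: (u) hy => // z u' hy; have [] := necklace_false hy.
    by rewrite mem_cat mem_head orbT.
  by move=> w [-> _].
- case: (lastP v) hy => [|v' z] hy.
    rewrite /last_pos /= rev_cons -cats1 index_cat mem_rev hv.
    rewrite (negbTE (notin_nseq _ true)) size_rev size_nseq /=.
    case: (x) => /=; first by rewrite addn0 subSnn /= drop0 take0 -hv.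
    by rewrite addn1 subnn; apply: (b1 (size u).+1).
  have hz : z = true.
    have [] := necklace_true hy; first by rewrite mem_cat mem_head orbT.
    by move=> w; rewrite -rcons_cons -rcons_cat => /rcons_inj [].
  rewrite hz in hy *.
  have -> : last_pos true (x :: rcons v' true ++ u) = (size v').+2.
    rewrite /last_pos rev_cons rev_cat rev_rcons rcons_cat index_cat mem_rev hv.
    rewrite (negbTE (notin_nseq _ true)) size_rev size_nseq /= size_cat size_rcons size_nseq; lia.
  by rewrite /= take_size_cat ?size_rcons // drop_size_cat ?size_rcons.
- by rewrite hv cats1 in hy *.
- by rewrite hv cats0 in hy *.
Qed.

End TreeStructure.

(** * Subtrees and the successor rule *)

Section Subtree.
Variables (n : nat) (i : cjtree) (T : {set n.-tuple bool}).
Hypothesis n_gt0 : 0 < n.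
Hypothesis T_necklace : forall x, x \in T -> necklace x.
Implicit Types x y z : n.-tuple bool.
Implicit Types s : seq bool.
Let b := flip_bit i.

Definition has_parent x : bool := (x != tree_root n i) && (parent i x \in T).

Definition on_edge s y : bool :=
  [&& y \in T, has_parent y & behead s == edge_core i y].

Definition succ_bit s : bool :=
  if [exists y, on_edge s y] then ~~ head false s else head false s.

Lemma strings_ofP (a : n.-tuple bool) :
  reflect (exists2 x, x \in T & conjugate x a) (a \in strings_of T).
Proof.
by apply: (iffP bigcupP) => -[x hx /(rotationsP n_gt0) h]; exists x.
Qed.

Lemma mem_subtree x s (a : n.-tuple bool) : necklace x -> conjugate x s ->
  a = s :> seq bool -> a \in strings_of T -> x \in T.
Proof.
move=> hx hs E /strings_ofP [y hy hya].
suff -> : x = y by [].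
apply/val_inj/necklace_conjugate_eq => //=; first exact: T_necklace.
by apply: conjugate_trans hs (conjugate_sym _); rewrite -E.
Qed.

Lemma PCR_succ_bit (a : n.-tuple bool) : a \in strings_of T ->
  PCR i (strings_of T) a = succ_bit a.
Proof.
move=> ha; rewrite /PCR /succ_bit.
set c1 := _ && _; set c2 := [exists y, _]; suff -> : c1 = c2 by [].
have hf : flip 1 a = ~~ head false a :: behead a :> seq bool.
  by rewrite val_flip //= take0 drop1 nth0.
have ea : a = head false a :: behead a :> seq bool.
  by case: a {ha c1 c2 hf} => -[|? ?] //= /eqP; lia.
have hrot : conjugate (flip 1 a) (rot_tuple 1 (flip 1 a)) by exists 1.
apply/andP/existsP => [[/(pcr_testP i n_gt0) [y [hy hr E]] hS]|].
  have hS' : flip 1 a \in strings_of T.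
    case/strings_ofP: hS => x hx h; apply/strings_ofP; exists x => //.
    exact: conjugate_trans h (conjugate_sym hrot).
  rewrite E in hf ea; exists y; rewrite /on_edge /has_parent hr E eqxx andbT.
  have := conjugate_child n_gt0 hy hr; have := conjugate_parent n_gt0 hy hr.
  have hp := necklace_parent n_gt0 hy hr.
  rewrite /= -/b; case: (head false a =P b) => hb h1 h2.
    rewrite hb in ea hf.
    by rewrite (mem_subtree hy h2 ea) // (mem_subtree hp h1 hf).
  have {}hb : head false a = ~~ b by move: hb; case: (b); case: head.
  rewrite hb negbK in ea hf.
  by rewrite (mem_subtree hy h2 hf) // (mem_subtree hp h1 ea).
case=> y /and3P [hyT /andP[hr hpT] /eqP E]; have hy := T_necklace hyT.
split; first by apply/pcr_testP => //; exists y.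
apply/strings_ofP.
have := conjugate_child n_gt0 hy hr; have := conjugate_parent n_gt0 hy hr.
rewrite -E -/b => h1 h2.
suff [x hx h] : exists2 x, x \in T & conjugate x (flip 1 a).
  by exists x => //; apply: conjugate_trans h hrot.
rewrite hf; case: (head false a =P b) => hb; first by exists (parent i y); rewrite ?hb.
by exists y => //; move: hb h2; case: (b); case: head.
Qed.

Definition down x y : bool := [&& x \in T, y \in T & is_child_of i y x].

Lemma downP x y : down x y ->
  [/\ x \in T, y \in T, y != tree_root n i, parent i y = x & has_parent y].
Proof.
by case/and3P => hx hy /andP[hr /eqP E]; split => //; rewrite /has_parent hr E.
Qed.

Lemma path_down x p : path down x p ->
  iter (size p) (parent i) (last x p) = x /\
  depth i (last x p) = size p + depth i x.
Proof.
elim/last_ind: p => // p y IH; rewrite rcons_path last_rcons size_rcons.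
case/andP=> /IH [h1 h2] /downP [_ hy hr E _].
rewrite iterSr E h1; split => //.
by rewrite (depth_parent n_gt0 (T_necklace hy) hr) E h2.
Qed.

Definition descendants x : {set n.-tuple bool} := [set z | connect down x z].

Lemma descendants_self x : x \in descendants x.
Proof. by rewrite inE connect0. Qed.

Lemma descendants_trans x y : down x y -> descendants y \subset descendants x.
Proof.
move=> h; apply/subsetP => z; rewrite !inE; apply: connect_trans.
exact: connect1.
Qed.

Lemma depth_down x y : down x y -> depth i y = (depth i x).+1.
Proof. by case/downP => _ hy hr <- _; apply: depth_parent => //; apply: T_necklace. Qed.

Lemma depth_descendants x z : z \in descendants x -> depth i x <= depth i z.
Proof.
by rewrite inE => /connectP [p /path_down [_ h] ->]; rewrite h leq_addl.
Qed.

Lemma descendants_child x y : down x y -> x \notin descendants y.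
Proof.
move=> h; apply/negP => /depth_descendants.
by rewrite (depth_down h) ltnn.
Qed.

Lemma card_descendants_child x y : down x y -> #|descendants y| < #|descendants x|.
Proof.
move=> h; apply/proper_card/properP; split; first exact: descendants_trans.
by exists x; [apply: descendants_self | apply: descendants_child].
Qed.

Lemma descendantsP x z : z \in descendants x ->
  z = x \/ exists2 y, down x y & z \in descendants y.
Proof.
rewrite inE => /connectP [[|y p] /= h ->]; [by left|right].
case/andP: h => h hp; exists y => //; rewrite inE.
by apply/connectP; exists p.
Qed.

Lemma descendants_disjoint x y y' z : down x y -> down x y' ->
  z \in descendants y -> z \in descendants y' -> y = y'.
Proof.
move=> h h'; rewrite !inE => /connectP [p hp Ep] /connectP [p' hp' Ep'].
have [h1 h2] := path_down hp; have [h1' h2'] := path_down hp'.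
rewrite -Ep in h1 h2; rewrite -Ep' in h1' h2'.
rewrite h2 (depth_down h) (depth_down h') in h2'.
move/addIn: h2' => E.
by rewrite -h1 -h1' E.
Qed.

Lemma sum_descendants x (F : n.-tuple bool -> nat) : x \in T ->
  \sum_(z in descendants x) F z =
  F x + \sum_(y in T | is_child_of i y x) \sum_(z in descendants y) F z.
Proof.
move=> hx; rewrite (bigD1 x) ?descendants_self //=; congr (_ + _).
have dE y : (y \in T) && is_child_of i y x = down x y by rewrite /down hx.
rewrite (eq_bigl _ _ dE).
rewrite (exchange_big_dep (fun z => (z \in descendants x) && (z != x))) /=.
  apply: eq_bigr => z /andP[/descendantsP [->|[y hy hz] _]]; first by rewrite eqxx.
  rewrite (big_pred1 y) // => y' /=; apply/andP/eqP => [[h1 h2]|-> //].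
  exact: descendants_disjoint h1 hy h2 hz.
move=> y z hy hz; rewrite (subsetP (descendants_trans hy)) //.
by apply: contraNneq (descendants_child hy) => <-.
Qed.

Lemma subtree_rootP : is_subtree i T ->
  [/\ subtree_root i T \in T, ~~ has_parent (subtree_root i T)
    & descendants (subtree_root i T) = T].
Proof.
case=> /set0Pn [x0 hx0] _ hconn.
rewrite /subtree_root; case: pickP => [r /= /andP[hr /forall_inP hmin]|]; last first.
  case: (arg_minnP (depth i) hx0) => x hx hmin /(_ x) /negP[].
  by apply/andP; split; last exact/forall_inP.
have hup : ~~ has_parent r.
  apply/negP => /andP[h1 /hmin]; rewrite (depth_parent n_gt0 (T_necklace hr) h1).
  by rewrite ltnn.
split => //; apply/setP => y; apply/idP/idP.
  rewrite inE => /connectP [p hp ->]; elim/last_ind: p hp => // p z _.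
  by rewrite rcons_path last_rcons => /andP[_ /downP[]].
move=> hy; have /connectP [p hp ->] := hconn r y hr hy.
elim/last_ind: p hp => [|p z IH]; first by rewrite descendants_self.
rewrite rcons_path last_rcons => /andP[/IH {}IH].
case/and3P => h1 h2 /orP [h|h]; last first.
  move: IH; rewrite !inE => IH; apply: connect_trans IH (connect1 _).
  by rewrite /down h1 h2.
have hd : down z (last r p) by rewrite /down h1 h2.
move: IH hd; rewrite !inE => /connectP [q hq ->].
case/lastP: q hq => [_ /downP [_ _ _ _]|q u]; first by rewrite /= (negbTE hup).
rewrite rcons_path last_rcons => /andP[hq /downP [_ _ _ E _]] /downP [_ _ _ E' _].
by apply/connectP; exists q; rewrite // -E' E.
Qed.

End Subtree.

(** * Walks following the successor rule *)

Lemma rot_split (s : seq bool) k : k < size s ->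
  rot k s = nth false s k :: drop k.+1 s ++ take k s.
Proof. by move=> hk; rewrite /rot (drop_nth false). Qed.

Lemma rot_succ (s : seq bool) k : k < size s ->
  rot k.+1 s = rcons (drop k.+1 s ++ take k s) (nth false s k).
Proof. by move=> hk; rewrite /rot (take_nth false) // rcons_cat. Qed.

Section Tours.
Variables (n : nat) (i : cjtree) (T : {set n.-tuple bool}).
Hypothesis n_gt0 : 0 < n.
Hypothesis T_necklace : forall x, x \in T -> necklace x.
Implicit Types x y z : n.-tuple bool.
Implicit Types s a E : seq bool.
Let b := flip_bit i.
Local Notation nextb := (succ_bit i T).
Local Notation has_parent := (has_parent i T).
Local Notation tree_edge := (down i T).
Local Notation descendants := (descendants i T).

Definition step s : seq bool := rcons (behead s) (nextb s).

Definition tour s E t : Prop :=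
  E = map nextb (traject step s (size E)) /\ t = iter (size E) step s.

Lemma tour_nil s : tour s [::] s.
Proof. by []. Qed.

Lemma tour_step s : tour s [:: nextb s] (step s).
Proof. by []. Qed.

Lemma tour_cat s E t E' u : tour s E t -> tour t E' u -> tour s (E ++ E') u.
Proof.
case=> h1 h2 [h1' h2']; split; last by rewrite size_cat addnC iterD -h2.
by rewrite size_cat trajectD map_cat -h2 -h1 -h1'.
Qed.

Definition covers (W : seq (seq bool)) x : Prop :=
  forall z v, z \in descendants x -> conjugate z v -> v \in W.

Lemma succ_bit_edge y s : y \in T -> has_parent y -> behead s = edge_core i y ->
  nextb s = ~~ head false s.
Proof.
move=> hy hp E; rewrite /succ_bit.
case: existsP => // -[]; exists y.
by rewrite /on_edge hy hp E eqxx.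
Qed.

Section Node.
Variables (x : n.-tuple bool) (a : seq bool) (c : nat).
Hypothesis xT : x \in T.
Hypothesis xa : conjugate x a.
Hypothesis c_range : 0 < c <= n.

Lemma size_label : size a = n.
Proof. by rewrite (conjugate_size xa) size_tuple. Qed.

Lemma range : 0 < c <= size a. Proof. by rewrite size_label. Qed.

Definition change_index y : nat := child_index a c (edge_label i y).

Lemma change_indexP y : tree_edge x y ->
  [/\ block a c < change_index y <= block a c + period a,
      change_index y <= n
    & rot (change_index y).-1 a = ~~ b :: edge_core i y].
Proof.
move=> /downP [_ hy hr hp _]; rewrite /change_index /child_index.
have hn := T_necklace hy; rewrite (edge_labelE n_gt0 hn hr) -/b.
have [hb1 hb2] := block_bounds range; rewrite size_label in hb2.
have pa : conjugate (parent i y) a by rewrite hp.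
have [k hk Ek] := conjugate_block range
  (conjugate_trans (conjugate_sym pa) (conjugate_parent n_gt0 hn hr)).
have split m : block a c < m <= block a c + period a ->
    rot m.-1 a = nth false a m.-1 :: drop m a ++ take m.-1 a.
  by move=> hm; rewrite rot_split prednK ?size_label //; lia.
set ms := [seq _ <- _ | _].
have msE m : (m \in ms) = (nth false a m.-1 == ~~ b) &&
    (drop m a ++ take m.-1 a == edge_core i y) &&
    (block a c < m <= block a c + period a).
  by rewrite mem_filter mem_iota.
have hms : head 0 ms \in ms.
  have : k.+1 \in ms; last by case: (ms) => // m ms' _; rewrite mem_head.
  have hk1 : block a c < k.+1 <= block a c + period a by lia.
  by have := split k.+1 hk1; rewrite msE /= -Ek => -[<- <-]; rewrite !eqxx.
move: hms; rewrite msE => /andP[/andP[/eqP h1 /eqP h2] hm].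
by split; [|lia|rewrite split // h1 h2].
Qed.

Definition kids : seq (nat * n.-tuple bool) :=
  sort (fun k1 k2 => k1.1 <= k2.1)
    [seq (child_index a c (edge_label i y), y) | y <- enum T & is_child_of i y x].

Lemma mem_kids k : (k \in kids) = tree_edge x k.2 && (k.1 == change_index k.2).
Proof.
rewrite mem_sort; apply/mapP/andP => [[y]|[h /eqP E]].
  by rewrite mem_filter mem_enum => /andP[h1 h2] -> /=; rewrite /down xT h1 h2.
exists k.2; last by rewrite [LHS]surjective_pairing E.
by case/and3P: h => _ h1 h2; rewrite mem_filter mem_enum h1 h2.
Qed.

Lemma change_index_inj y y' : tree_edge x y -> tree_edge x y' ->
  change_index y = change_index y' -> y = y'.
Proof.
move=> h h' E; have [_ _ E1] := change_indexP h; have [_ _] := change_indexP h'.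
rewrite -E E1 => -[Ec].
have [_ hy hr _ _] := downP h; have [_ hy' hr' _ _] := downP h'.
apply/val_inj/necklace_conjugate_eq => /=; try exact: T_necklace.
apply: conjugate_trans (conjugate_child n_gt0 (T_necklace hy) hr) _.
by rewrite Ec; apply/conjugate_sym/conjugate_child => //; apply: T_necklace.
Qed.

Lemma kids_at m : let ks := [seq k <- kids | k.1 == m] in
  ks = [::] \/ exists2 y, tree_edge x y /\ change_index y = m & ks = [:: (m, y)].
Proof.
set ks := filter _ _ => /=.
have hks k : k \in ks -> [/\ tree_edge x k.2, change_index k.2 = m & k = (m, k.2)].
  rewrite mem_filter mem_kids => /and3P[/eqP h1 h2 /eqP h3]; split => //.
    by rewrite -h3.
  by rewrite -h1 -surjective_pairing.
have uks : uniq ks.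
  rewrite filter_uniq // sort_uniq map_inj_uniq => [|y y' []//].
  by rewrite filter_uniq ?enum_uniq.
case: ks hks uks => [|k [|k' ks]] hks uks; [by left|right|].
  have [h1 h2 h3] := hks k (mem_head _ _).
  by exists k.2; rewrite // -h3.
have [h1 h2 h3] := hks k (mem_head _ _).
have [|h1' h2' h3'] := hks k'; first by rewrite !inE eqxx orbT.
move: uks; rewrite h3 h3' (change_index_inj h1 h1') ?h2 //.
by rewrite /= mem_head.
Qed.

Lemma kids_between_succ m1 m2 : m1 <= m2 ->
  [seq k <- kids | m1 < k.1 <= m2.+1] =
  [seq k <- kids | m1 < k.1 <= m2] ++ [seq k <- kids | k.1 == m2.+1].
Proof.
move=> hm; have : sorted (fun k1 k2 : nat * n.-tuple bool => k1.1 <= k2.1) kids.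
  by apply: sort_sorted => k1 k2; apply: leq_total.
elim: kids => //= k ks IH; rewrite path_sortedE; last by move=> ? ? ?; apply: leq_trans.
case/andP=> /allP hk /IH ->.
case: (ltngtP k.1 m2.+1) => h.
- have -> : (k.1 <= m2) = true by lia.
  by rewrite andbT; case: ifP.
- have -> : (k.1 <= m2) = false by lia.
  by rewrite andbF.
have -> : (k.1 <= m2) = false by lia.
rewrite h ltnS hm /= -h.
rewrite (_ : [seq k0 <- ks | m1 < k0.1 <= m2] = [::]) //.
apply/eqP; rewrite -[_ == _]negbK -has_filter; apply/hasPn => k' /hk.
by rewrite h; lia.
Qed.

Lemma child_label_rot y (m := change_index y) (a' := child_label a m (edge_label i y)) :
  tree_edge x y ->
  [/\ conjugate y a', rot m.-1 a' = b :: edge_core i y,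
      take m.-1 a' = take m.-1 a & take m a' = rcons (take m.-1 a) b].
Proof.
move=> h; have [hm1 hm2 Em] := change_indexP h; rewrite -/m in hm1 hm2 Em.
have [_ /T_necklace hy hr _ _] := downP h.
have E : a' = take m.-1 a ++ b :: drop m a.
  by rewrite /a' /child_label edge_labelE.
have hs : size (take m.-1 a) = m.-1 by rewrite size_takel // size_label; lia.
have Ec : rot m.-1 a' = b :: edge_core i y.
  rewrite E -[X in rot X]hs rot_size_cat /=; congr (_ :: _).
  move: Em; rewrite rot_split ?size_label; last by lia.
  by rewrite prednK => [[_ ->]|] //; lia.
split => //.
- apply: conjugate_trans (conjugate_child n_gt0 hy hr) _.
  by apply: conjugate_sym; exists m.-1.
- by rewrite E take_size_cat.
by rewrite E -cat_rcons take_size_cat // size_rcons hs prednK //; lia.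
Qed.

(* The identity a_1 ... a_c E = w a_1 ... a_(c-1) for the child y. *)
Definition subtree_word_ok (W : seq bool) y : Prop :=
  let m := change_index y in
  let a' := child_label a m (edge_label i y) in
  exists E, [/\ tour (rot m a') E (rot m.-1 a'),
    take m a' ++ E = W ++ take m.-1 a'
    & covers (traject step (rot m a') (size E).+1) y].

Variable W : nat * n.-tuple bool -> seq bool.
Hypothesis W_ok : forall k, k \in kids -> subtree_word_ok (W k) k.2.

Lemma tour_segment k : block a c <= k < block a c + period a ->
  (has_parent x -> rot k a <> b :: edge_core i x) ->
  exists E, [/\ tour (rot k a) E (rot k.+1 a),
    take k a ++ E = flatten (map W [seq k' <- kids | k'.1 == k.+1]) ++ take k.+1 a,
    rot k a \in traject step (rot k a) (size E)
    & forall k', k' \in kids -> k'.1 = k.+1 ->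
        covers (traject step (rot k a) (size E)) k'.2].
Proof.
move=> hk hup; have [hb1 hb2] := block_bounds range.
have hka : k < size a by lia.
have := rot_split hka; have := rot_succ hka.
set r := drop _ _ ++ _ => Es Ek.
have hin k' : k' \in kids -> k'.1 = k.+1 -> k' \in [seq k' <- kids | k'.1 == k.+1].
  by move=> h1 h2; rewrite mem_filter h2 eqxx.
case: (kids_at k.+1) hin => /= [-> hin|[y [hy hm] Eks] hin].
  have Es' : step (rot k a) = rot k.+1 a.
    rewrite /step Es Ek /=; congr rcons; rewrite /succ_bit.
    case: existsP => // -[y /and3P [hyT hyp /eqP /= Er]]; exfalso.
    have /andP[hr hpT] := hyp; have hn := T_necklace hyT.
    case: (nth false a k =P b) => hak.
      rewrite hak Er in Ek; have hxy : x = y.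
        apply/val_inj/necklace_conjugate_eq; [exact: T_necklace|exact: hn|].
        apply: conjugate_trans xa _.
        apply: conjugate_trans (conjugate_sym (conjugate_child n_gt0 hn hr)).
        by rewrite -/b -Ek; exists k.
      by move: hup; rewrite hxy => /(_ hyp); apply; rewrite Ek -hxy.
    have {}hak : nth false a k = ~~ b by move: hak; case: (b); case: nth.
    rewrite hak Er in Ek; have hxy : parent i y = x.
      apply/val_inj/necklace_conjugate_eq; [exact: T_necklace|exact: T_necklace|].
      apply: conjugate_trans (conjugate_parent n_gt0 hn hr) _.
      by rewrite -/b -Ek; apply: conjugate_sym; apply: conjugate_trans xa _; exists k.
    have hd : tree_edge x y by rewrite /down xT hyT /is_child_of hr hxy eqxx.
    have [h1 h2 h3] := change_indexP hd; rewrite -Ek in h3.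
    have h4 : (change_index y).-1 = k by apply: (rot_block_inj range) h3; lia.
    have := hin (k.+1, y); rewrite mem_kids hd /= => H.
    suff : (k.+1, y) \in [::] by [].
    by apply: H => //; apply/eqP; lia.
  exists [:: nextb (rot k a)]; split.
  - by rewrite -Es'; apply: tour_step.
  - have -> : nextb (rot k a) = nth false a k.
      by move: Es'; rewrite /step Es => /rcons_inj [].
    by rewrite (take_nth false hka) cats1.
  - by rewrite inE.
  - by move=> k' h1 h2; have := hin k' h1 h2.
have hW : subtree_word_ok (W (k.+1, y)) y.
  by apply: (W_ok (k := (k.+1, y))); rewrite mem_kids hy hm /=.
case: hW => E []; have [hya] := child_label_rot hy.
set a' := child_label _ _ _ in hya *; rewrite hm /= => ha1 ha2 ha3 ht hw hc.
have [_ _ Em] := change_indexP hy.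
rewrite hm /= Ek in Em; case: Em => Ek1 Ek2.
have [_ hyT hr _ hp] := downP hy.
rewrite Ek1 Ek2 in Ek Es.
have sb1 : nextb (rot k a) = b.
  by rewrite (succ_bit_edge hyT hp) Ek // negbK.
have sb2 : nextb (rot k a') = ~~ b.
  by rewrite (succ_bit_edge hyT hp) ha1.
have st1 : step (rot k a) = rot k.+1 a'.
  rewrite /step sb1 Ek /=.
  have hka' : k < size a' by rewrite (conjugate_size hya) size_tuple -size_label.
  have := rot_split hka'; have := rot_succ hka'.
  by rewrite ha1 => -> [<- <-].
have st2 : step (rot k a') = rot k.+1 a by rewrite /step sb2 ha1 Es.
exists (b :: E ++ [:: ~~ b]).
have Etr : traject step (rot k a) (size (b :: E ++ [:: ~~ b])) =
    rot k a :: traject step (rot k.+1 a') (size E).+1.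
  by rewrite /= size_cat addn1 -st1.
split.
- have t1 : tour (rot k a) [:: b] (rot k.+1 a').
    by rewrite -st1 -sb1; apply: tour_step.
  have t2 : tour (rot k a') [:: ~~ b] (rot k.+1 a).
    by rewrite -st2 -sb2; apply: tour_step.
  exact: tour_cat t1 (tour_cat ht t2).
- rewrite Eks /= cats0 -cat_rcons -ha3.
  by rewrite catA hw ha2 (take_nth false hka) Ek1 -catA cats1.
- by rewrite Etr mem_head.
- move=> k' h1 h2; have := hin k' h1 h2; rewrite Eks inE => /eqP ->.
  by move=> z v hz hv; rewrite Etr inE; apply/orP; right; apply: hc hz hv.
Qed.

Lemma tour_segments k0 k1 :
  block a c <= k0 <= k1 -> k1 <= block a c + period a ->
  (forall k, k0 <= k < k1 -> has_parent x -> rot k a <> b :: edge_core i x) ->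
  exists E, [/\ tour (rot k0 a) E (rot k1 a),
    take k0 a ++ E = flatten (map W [seq k' <- kids | k0 < k'.1 <= k1]) ++ take k1 a,
    forall k, k0 <= k < k1 -> rot k a \in traject step (rot k0 a) (size E)
    & forall k', k' \in kids -> k0 < k'.1 <= k1 ->
        covers (traject step (rot k0 a) (size E)) k'.2].
Proof.
case/andP=> hk0 hk01; rewrite -(subnKC hk01); elim: (k1 - k0) => [|d IH] hd hup.
  exists [::]; rewrite addn0; split.
  - exact: tour_nil.
  - rewrite cats0 (_ : filter _ _ = [::]) //.
    by apply/eqP; rewrite -[_ == _]negbK -has_filter; apply/hasPn => k' _; lia.
  - by move=> k; lia.
  - by move=> k' _; lia.
have [|k hk|E [h1 h2 h3 h4]] := IH; [by lia|by apply: hup; lia|].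
have [||E' [h1' h2' h3' h4']] := @tour_segment (k0 + d); [by lia|by apply: hup; lia|].
have Etr : traject step (rot k0 a) (size (E ++ E')) =
    traject step (rot k0 a) (size E) ++ traject step (rot (k0 + d) a) (size E').
  by rewrite size_cat trajectD -(proj2 h1).
exists (E ++ E'); rewrite Etr addnS; split.
- exact: tour_cat h1 h1'.
- rewrite catA h2 -catA h2' kids_between_succ; last by lia.
  by rewrite map_cat flatten_cat catA.
- move=> k hk; rewrite mem_cat; case: (ltngtP k (k0 + d)) => h; last 1 first.
  + by rewrite h h3' orbT.
  + by rewrite h3 //; lia.
  + by lia.
- move=> k' hk' hr z v hz hv; rewrite mem_cat.
  case: (ltngtP k'.1 (k0 + d).+1) => h; last 1 first.
  + by rewrite (h4' k' hk' h z v hz hv) orbT.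
  + by rewrite (h4 k' hk' _ z v hz hv) //; lia.
  + by lia.
Qed.

End Node.
End Tours.

(** * Concatenation trees *)

Lemma RCL_node a c ls rs : RCL (CNode a c ls rs) =
  flatten (map RCL rs) ++ ap a ++ flatten (map RCL ls).
Proof.
have RCL_flatten ts : aps (flatten (map rcl_labels ts)) = flatten (map RCL ts).
  by elim: ts => //= t ts <-; rewrite /aps map_cat flatten_cat.
by rewrite -!RCL_flatten /RCL /= /aps map_cat flatten_cat.
Qed.

Section Count.
Variables (n : nat).
Hypothesis n_gt0 : 0 < n.
Implicit Types x : n.-tuple bool.

Lemma card_rotations x a : conjugate x a -> #|rotations x| = period a.
Proof.
move=> h; have hs : size a == n by rewrite (conjugate_size h) size_tuple.
have sa : size a = n by apply/eqP.
have h1 : 0 < 1 <= size a by lia.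
have bl0 : block a 1 = 0 by rewrite /block div0n.
have [hb1 hb2] := block_bounds h1; rewrite bl0 in hb1 hb2.
have -> : rotations x = [set rot_tuple k (Tuple hs) | k : 'I_(period a)].
  apply/setP => v; apply/(rotationsP n_gt0)/imsetP => [hv|[k _ ->]]; last first.
    by apply: conjugate_trans h _; exists k.
  have [k hk E] := conjugate_block h1 (conjugate_trans (conjugate_sym h) hv).
  rewrite bl0 /= in hk.
  by exists (Ordinal hk) => //; apply: val_inj.
rewrite card_imset ?card_ord // => j k [E]; apply: val_inj.
apply: (rot_block_inj h1) E; rewrite bl0 /=; exact: ltn_ord.
Qed.

Lemma card_strings_of (T : {set n.-tuple bool}) :
  (forall x, x \in T -> necklace x) ->
  #|strings_of T| = \sum_(x in T) #|rotations x|.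
Proof.
move=> hT; rewrite -sum1_card; symmetry.
rewrite (eq_bigr (fun x => \sum_(v in rotations x) 1)) => [|x _]; last by rewrite sum1_card.
rewrite (exchange_big_dep (fun v => v \in strings_of T)) /=; last first.
  by move=> x v hx hv; apply/bigcupP; exists x.
apply: eq_bigr => v /(strings_ofP T n_gt0) [x hx hv].
rewrite (big_pred1 x) // => x' /=; apply/andP/eqP => [[h1 /(rotationsP n_gt0) h2]|->].
  apply/val_inj/necklace_conjugate_eq => /=; try exact: hT.
  exact: conjugate_trans h2 (conjugate_sym hv).
by split => //; apply/(rotationsP n_gt0).
Qed.

End Count.

Section Concatenation.
Variables (n : nat) (i : cjtree) (T : {set n.-tuple bool}) (l : side).
Hypothesis n_gt0 : 0 < n.
Hypothesis T_necklace : forall x, x \in T -> necklace x.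
Implicit Types x y z : n.-tuple bool.
Let b := flip_bit i.
Local Notation step := (step i T).
Local Notation tour := (tour i T).
Local Notation covers := (covers i T).

Lemma tour_round x a c (W : nat * n.-tuple bool -> seq bool) d1 d2
    (ks := kids i T x a c) (lo := block a c) (hi := block a c + period a) :
  x \in T -> conjugate x a -> 0 < c <= n ->
  (forall k, k \in ks -> subtree_word_ok i T a c (W k) k.2) ->
  lo <= d1 <= hi -> lo <= d2 <= hi ->
  (forall k, d1 <= k < hi \/ lo <= k < d2 ->
    has_parent i T x -> rot k a <> b :: edge_core i x) ->
  exists E, [/\ tour (rot d1 a) E (rot d2 a),
    take d1 a ++ E = flatten (map W [seq k <- ks | d1 < k.1]) ++ ap a ++
      flatten (map W [seq k <- ks | k.1 <= d2]) ++ take d2 a,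
    forall k, d1 <= k < hi \/ lo <= k < d2 -> rot k a \in traject step (rot d1 a) (size E)
    & forall k, k \in ks -> d1 < k.1 \/ k.1 <= d2 ->
        covers (traject step (rot d1 a) (size E)) k.2].
Proof.
move=> xT xa hc W_ok h1 h2 hup; have hr := range xa hc.
have ks_range k : k \in ks -> lo < k.1 <= hi.
  rewrite mem_kids // => /andP[hd /eqP ->].
  by case: (change_indexP n_gt0 T_necklace xT xa hc hd).
have [||k hk|E [t1 w1 s1 c1]] :=
    @tour_segments n i T n_gt0 T_necklace x a c xT xa hc W W_ok d1 hi.
- exact: h1.
- by [].
- by apply: hup; left.
have [||k hk|E' [t2 w2 s2 c2]] :=
    @tour_segments n i T n_gt0 T_necklace x a c xT xa hc W W_ok lo d2.
- by lia.
- by lia.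
- by apply: hup; right.
rewrite rot_block_end // in t1; rewrite rot_block // in t2 s2 c2.
have Etr : traject step (rot d1 a) (size (E ++ E')) =
    traject step (rot d1 a) (size E) ++ traject step a (size E').
  by rewrite size_cat trajectD -(proj2 t1).
exists (E ++ E'); rewrite Etr; split.
- exact: tour_cat t1 t2.
- rewrite catA w1 take_block_end // -!catA w2.
  congr (flatten (map W _) ++ _ ++ flatten (map W _) ++ _);
    apply: eq_in_filter => k /ks_range /andP[g1 g2] /=;
    by rewrite ?g1 ?g2 ?andbT.
- by move=> k [] hk; rewrite mem_cat; apply/orP; [left; apply: s1|right; apply: s2].
- move=> k hk hd z v hz hv; rewrite mem_cat; have := ks_range k hk.
  case: hd => hd hk'; apply/orP.
    by left; apply: (c1 k hk _ z) => //; lia.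
  by right; apply: (c2 k hk _ z) => //; lia.
Qed.

Lemma concat_below_tour fuel x a c (w := RCL (concat_below i T l fuel x a c)) :
  x \in T -> conjugate x a -> 0 < c <= n -> #|descendants i T x| <= fuel ->
  [/\ size w = \sum_(z in descendants i T x) #|rotations z|,
      has_parent i T x -> rot c.-1 a = b :: edge_core i x ->
        exists E, [/\ tour (rot c a) E (rot c.-1 a),
          take c a ++ E = w ++ take c.-1 a
          & covers (traject step (rot c a) (size E).+1) x]
    & ~~ has_parent i T x -> exists d C, [/\ tour (rot d a) C (rot d a),
          take d a ++ C = w ++ take d a
          & covers (traject step (rot d a) (size C)) x]].
Proof.
rewrite {}/w; elim: fuel x a c => [|fuel IH] x a c xT xa hc hD.
  move: hD; rewrite leqn0 cards_eq0 => /eqP hD.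
  by have := descendants_self i T x; rewrite hD inE.
have -> : concat_below i T l fuel.+1 x a c =
    CNode a c
      [seq concat_below i T l fuel k.2 (child_label a k.1 (edge_label i k.2)) k.1
      | k <- kids i T x a c & goes_left l c k.1]
      [seq concat_below i T l fuel k.2 (child_label a k.1 (edge_label i k.2)) k.1
      | k <- kids i T x a c & ~~ goes_left l c k.1] by [].
pose W (k : nat * n.-tuple bool) :=
  RCL (concat_below i T l fuel k.2 (child_label a k.1 (edge_label i k.2)) k.1).
rewrite RCL_node -!map_comp -!/(map W _).
set ks := kids i T x a c.
have hr := range xa hc; have [hb1 hb2] := block_bounds hr.
have sa := size_label xa.
have ks_range k : k \in ks -> block a c < k.1 <= block a c + period a.
  rewrite mem_kids // => /andP[hd /eqP ->].
  by case: (change_indexP n_gt0 T_necklace xT xa hc hd).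
have IHk k : k \in ks ->
    size (W k) = \sum_(z in descendants i T k.2) #|rotations z| /\
    subtree_word_ok i T a c (W k) k.2.
  move=> hk; have hkr := ks_range k hk.
  move: hk; rewrite mem_kids // => /andP[hd /eqP Em].
  have [h1 h2 _ _] := child_label_rot n_gt0 T_necklace xT xa hc hd.
  have [_ hy _ _ hp] := downP hd.
  have hm : 0 < k.1 <= n by lia.
  rewrite -Em in h1 h2.
  have [|g1 g2 _] := IH k.2 _ k.1 hy h1 hm.
    by have := card_descendants_child n_gt0 T_necklace hd; lia.
  by split; rewrite /subtree_word_ok -?Em //; apply: g2.
have W_ok k (hk : k \in ks) := proj2 (IHk k hk).
split.
- rewrite !size_cat addnCA size_ap; last by lia.
  rewrite sum_descendants // (card_rotations n_gt0 xa); congr (_ + _).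
  have size_W (ks' : seq (nat * n.-tuple bool)) :
      size (flatten (map W ks')) = \sum_(k <- ks') size (W k).
    by rewrite size_flatten /shape sumnE !big_map.
  rewrite !size_W !big_filter addnC.
  transitivity (\sum_(k <- ks) size (W k)).
    by rewrite [RHS](bigID (fun k => goes_left l c k.1)).
  rewrite (eq_big_seq (fun k => \sum_(z in descendants i T k.2) #|rotations z|)); last first.
    by move=> k /IHk [].
  rewrite /ks /kids (perm_big _ (permEl (perm_sort _ _))) /= big_map big_filter.
  by rewrite big_enum_cond.
- move=> hp Ec; have Ecp : c.-1.+1 = c by lia.
  have noc k : k \in ks -> k.1 != c.
    rewrite mem_kids // => /andP[hd /eqP ->]; apply/eqP => Em.
    have [_ _] := change_indexP n_gt0 T_necklace xT xa hc hd.
    by rewrite Em Ec -/b; case: (b).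
  have [|||E [t w s cv]] := @tour_round x a c W c c.-1 xT xa hc W_ok.
  + by lia.
  + by lia.
  + move=> k hk _ Ek; have hk' : block a c <= k < block a c + period a by lia.
    have hc' : block a c <= c.-1 < block a c + period a by lia.
    by have := rot_block_inj hr hk' hc'; rewrite Ek Ec => /(_ erefl); lia.
  exists E; split => //.
    rewrite w -!catA; congr (flatten (map W _) ++ _ ++ flatten (map W _) ++ _);
    apply: eq_in_filter => -[m y] /noc /=; rewrite /goes_left;
    case: eqP => //= hmc _; move: hmc; lia.
  move=> z v hz hv; rewrite trajectSr mem_rcons inE -(proj2 t).
  case: (descendantsP hz) => [Ez|[y hd hzy]].
    rewrite Ez in hv.
    have [k hk ->] := conjugate_block hr (conjugate_trans (conjugate_sym xa) hv).
    case: (eqVneq k c.-1) => [->|hkc]; first by rewrite eqxx.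
    by rewrite s ?orbT //; lia.
  have hk : (change_index i a c y, y) \in ks by rewrite mem_kids // hd eqxx.
  have := noc _ hk => /= hkc; rewrite (cv _ hk _ z v hzy hv) ?orbT //=; lia.
move=> hp; pose d := if l is Left then c else c.-1.
have [|||E [t w s cv]] := @tour_round x a c W d d xT xa hc W_ok.
- by rewrite /d; case: (l); lia.
- by rewrite /d; case: (l); lia.
- by move=> k _ hp'; rewrite hp' in hp.
exists d, E; split => //.
  rewrite w -!catA; congr (flatten (map W _) ++ _ ++ flatten (map W _) ++ _);
  apply: eq_in_filter => -[m y] _ /=; rewrite /goes_left /d; case: (l) => /=; lia.
move=> z v hz hv; case: (descendantsP hz) => [Ez|[y hd hzy]].
  rewrite Ez in hv.
  have [k hk ->] := conjugate_block hr (conjugate_trans (conjugate_sym xa) hv).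
  by apply: s; lia.
have hk : (change_index i a c y, y) \in ks by rewrite mem_kids // hd eqxx.
by apply: (cv _ hk _ z) => //=; lia.
Qed.

End Concatenation.

Section ClosedTour.
Variables (n : nat) (i : cjtree) (T : {set n.-tuple bool}).
Hypothesis n_gt0 : 0 < n.
Local Notation succ_bit := (succ_bit i T).
Local Notation step := (step i T).

Lemma nth_cyclic_shift (p u w : seq bool) j : p ++ u = w ++ p -> 0 < size u ->
  nth false w ((size p + j) %% size w) = nth false u (j %% size u).
Proof.
move=> E u0; have Es : size u = size w.
  by have := congr1 size E; rewrite !size_cat; lia.
have Eq q : p ++ flatten (nseq q u) = flatten (nseq q w) ++ p.
  elim: q => [|q IH] /=; first by rewrite cats0.
  by rewrite catA E -!catA IH.
have [q hq] : exists q, size p + j < q * size w.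
  by exists (size p + j).+1; rewrite -Es; nia.
rewrite -(nth_flatten_nseq hq).
have := congr1 (fun s => nth false s (size p + j)) (Eq q).
rewrite !nth_cat size_flatten_nseq hq => <-.
rewrite ltnNge leq_addr /= addKn nth_flatten_nseq // Es.
by apply: leq_ltn_trans hq; apply: leq_addl.
Qed.

Lemma iter_step (s : seq bool) k : k <= size s ->
  iter k step s = drop k s ++ mkseq (fun j => succ_bit (iter j step s)) k.
Proof.
elim: k => [|k IH] hk; first by rewrite drop0 cats0.
rewrite mkseqS iterS {1}/step IH; last exact: ltnW.
rewrite (drop_nth false hk) /= rcons_cat; congr (_ ++ rcons _ _).
Qed.

Lemma closed_tour_windows (s p u w : seq bool) k :
  size s = n -> 0 < size u -> tour i T s u s -> p ++ u = w ++ p ->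
  cyclic_substring n w (size p + k) = iter (k + n) step s /\
  nth false w ((size p + k + n) %% size w) = succ_bit (iter (k + n) step s).
Proof.
move=> hs u0 [Eu Es] E.
have iter_mod j : iter (j %% size u) step s = iter j step s.
  rewrite {2}(divn_eq j (size u)) addnC iterD; congr iter.
  by elim: (j %/ size u) => // q IH; rewrite mulSn addnC iterD -Es.
have wE j : nth false w ((size p + j) %% size w) = succ_bit (iter j step s).
  rewrite (nth_cyclic_shift _ E u0) -(iter_mod j).
  have hj : j %% size u < size u by rewrite ltn_mod.
  by rewrite {1}Eu (nth_map s) ?size_traject // nth_traject.
split; last by rewrite -addnA wE.
have size_step j : size (iter j step s) = n.
  by elim: j => //= j; rewrite size_rcons size_behead => ->; rewrite prednK.
rewrite [in RHS]addnC iterD iter_step ?size_step // drop_oversize ?size_step //.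
by apply: eq_mkseq => j; rewrite -addnA wE addnC iterD.
Qed.

End ClosedTour.
Theorem theorem4 (n : nat) (hn : 1 <= n) (i : cjtree)
    (T : {set n.-tuple bool}) (hT : is_subtree i T)
    (c : nat) (hc : 1 <= c <= n) (l : side) :
  let U := RCL (concat i T c l) in
  universal_cycle U (strings_of T) /\
  has_successor_rule U (strings_of T) (PCR i (strings_of T)).
Proof.
move=> U; have T_necklace : forall x, x \in T -> necklace x by case: hT.
have [rT rtop rdesc] := subtree_rootP hn T_necklace hT.
have hD : #|descendants i T (subtree_root i T)| <= #|T| by rewrite rdesc.
have [sizeU _ closed] :=
  concat_below_tour l hn T_necklace rT (conjugate_refl _) hc hD.
have [d [C [tourC wordC coverC]]] := closed rtop.
rewrite -/(concat i T c l) -/U rdesc -card_strings_of // in sizeU wordC.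
set p := take d _ in wordC; set s := rot d _ in tourC coverC.
have sizeC : size C = size U.
  by have := congr1 size wordC; rewrite !size_cat; lia.
have size_s : size s = n by rewrite size_rot size_tuple.
have C_gt0 : 0 < size C.
  rewrite sizeC sizeU; apply/card_gt0P; exists (subtree_root i T).
  by apply/(strings_ofP T hn); exists (subtree_root i T) => //; apply: conjugate_refl.
have windows k := closed_tour_windows hn k size_s C_gt0 tourC wordC.
have cyclicP m : cyclic_substring n U (m %% size U) = cyclic_substring n U m.
  by apply: eq_mkseq => j; rewrite modnDml.
have found (a : n.-tuple bool) : a \in strings_of T ->
    exists2 m, m < size U & cyclic_substring n U m = a.
  move=> /(strings_ofP T hn) [x xT xa].
  have := coverC x a; rewrite rdesc => /(_ xT xa) /trajectP [q hq ->].
  pose k := q + n * size C - n.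
  have hk : k + n = n * size C + q by rewrite /k; nia.
  exists ((size p + k) %% size U); first by rewrite ltn_mod -sizeC.
  rewrite cyclicP (windows k).1 hk addnC iterD; congr iter.
  have period_step m : iter (m * size C) (step i T) s = s.
    by elim: m => // m IH; rewrite mulSn addnC iterD -(proj2 tourC).
  exact: period_step.
split.
  split => // a /found [m hm Em]; exists (Ordinal hm); split => // m' Em'.
  have /mkseq_uniqP inj : uniq (mkseq (cyclic_substring n U) (size U)).
    apply: (@leq_size_uniq _ (map val (enum (strings_of T)))).
    - by rewrite map_inj_uniq ?enum_uniq //; apply: val_inj.
    - move=> v /mapP [a']; rewrite mem_enum => /found [k hk /= Ek] ->.
      by rewrite -Ek; apply: map_f; rewrite mem_iota.
    - by rewrite size_mkseq size_map -cardE sizeU.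
  by apply/val_inj/inj; rewrite ?inE /= ?ltn_ord // Em Em'.
move=> a m ha Em; rewrite PCR_succ_bit // -Em.
pose k := m + size p * size U - size p.
have hk : size p + k = size p * size U + m.
  have : 0 < size U by rewrite -sizeC.
  by rewrite /k; nia.
have [w1 w2] := windows k; rewrite hk in w1 w2.
rewrite -cyclicP modnMDl cyclicP in w1; rewrite w1 -w2.
by rewrite -addnA modnMDl.
Qed.
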